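(* For any $r\ge 1$ and any positive integers $k_1,\ldots,k_r$, the following identity holds in $\mathcal{A}$: $$\zeta_{\mathcal{A}}^{(2)}(k_{1},\dots,k_{r})=(-1)^{r+k_{1}+\cdots+k_{r}}\sum_{i=0}^{r}(-1)^{i}\,\zeta_{\mathcal{A}}(k_{i},\dots,k_{1})\,\zeta_{\mathcal{A}}^{(2),\star}(k_{i+1},\dots,k_{r}).$$
   Context: Let $\mathcal{A}=\left(\prod_{p}\mathbb{Z}/p\mathbb{Z}\right)/\left(\bigoplus_{p}\mathbb{Z}/p\mathbb{Z}\right)$, where $p$ runs over all prime numbers; it is a $\mathbb{Q}$-algebra. Thus an element of $\mathcal{A}$ is represented by a family $(a_{(p)})_p$ with $a_{(p)}\in\mathbb{Z}/p\mathbb{Z}$, and two families represent the same element iff they agree for all but finitely many $p$. An index is a tuple of positive integers. For an index $(k_1,\ldots,k_r)$, define elements of $\mathcal{A}$ by $$\zeta_{\mathcal{A}}(k_1,\ldots,k_r)_{(p)}=\sum_{0<m_1<\cdots<m_r<p}\frac{1}{m_1^{k_1}\cdots m_r^{k_r}}\bmod p,$$ $$\zeta_{\mathcal{A}}^{(2)}(k_1,\ldots,k_r)_{(p)}=\sum_{0<m_1<\cdots<m_r<p/2}\frac{1}{m_1^{k_1}\cdots m_r^{k_r}}\bmod p,$$ $$\zeta_{\mathcal{A}}^{(2),\star}(k_1,\ldots,k_r)_{(p)}=\sum_{0<m_1\le\cdots\le m_r<p/2}\frac{1}{m_1^{k_1}\cdots m_r^{k_r}}\bmod p.$$ For the empty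 index, all three are set equal to $1$; in the sum, the $i=0$ term has $\zeta_{\mathcal{A}}(\emptyset)=1$ and the $i=r$ term has $\zeta_{\mathcal{A}}^{(2),\star}(\emptyset)=1$. *)

(* Defs.v *)
From HB Require Import structures.
From mathcomp Require Import all_boot all_order all_algebra generic_quotient ring_quotient.
From mathcomp Require Import boolp classical_sets cardinality.

Set Implicit Arguments.
Unset Strict Implicit.
Unset Printing Implicit Defensive.

Import GRing.Theory.

Local Open Scope ring_scope.
Local Open Scope quotient_scope.

Definition prime_nat : Type := {p : nat | prime p}.

(** The ring of families (a_(p))_p with a_(p) in Z/pZ, p ranging over all primes. *)
Definition prod_Fp : Type := forall p : prime_nat, 'F_(val p).

HB.instance Definition _ := gen_eqMixin prod_Fp.
HB.instance Definition _ := gen_choiceMixin prod_Fp.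

Section ProdRing.

Implicit Types a b c : prod_Fp.

Definition prod_zero : prod_Fp := fun=> 0.
Definition prod_one : prod_Fp := fun=> 1.
Definition prod_opp a : prod_Fp := fun p => - a p.
Definition prod_add a b : prod_Fp := fun p => a p + b p.
Definition prod_mul a b : prod_Fp := fun p => a p * b p.

Lemma prod_addA : associative prod_add.
Proof. by move=> a b c; apply: functional_extensionality_dep => p; apply: addrA. Qed.

Lemma prod_addC : commutative prod_add.
Proof. by move=> a b; apply: functional_extensionality_dep => p; apply: addrC. Qed.

Lemma prod_add0 : left_id prod_zero prod_add.
Proof. by move=> a; apply: functional_extensionality_dep => p; apply: add0r. Qed.

Lemma prod_addN : left_inverse prod_zero prod_opp prod_add.
Proof. by move=> a; apply: functional_extensionality_dep => p; apply: addNr. Qed.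

Lemma prod_mulA : associative prod_mul.
Proof. by move=> a b c; apply: functional_extensionality_dep => p; apply: mulrA. Qed.

Lemma prod_mulC : commutative prod_mul.
Proof. by move=> a b; apply: functional_extensionality_dep => p; apply: mulrC. Qed.

Lemma prod_mul1 : left_id prod_one prod_mul.
Proof. by move=> a; apply: functional_extensionality_dep => p; apply: mul1r. Qed.

Lemma prod_mulDl : left_distributive prod_mul prod_add.
Proof. by move=> a b c; apply: functional_extensionality_dep => p; apply: mulrDl. Qed.

Lemma prod_one_neq0 : prod_one != prod_zero.
Proof.
apply/eqP => /(congr1 (fun a : prod_Fp => a (exist _ 2%N isT))) /eqP.
by rewrite /prod_one /prod_zero oner_eq0.
Qed.

End ProdRing.

HB.instance Definition _ :=
  GRing.isZmodule.Build prod_Fp prod_addA prod_addC prod_add0 prod_addN.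
HB.instance Definition _ :=
  GRing.Zmodule_isComNzRing.Build prod_Fp
    prod_mulA prod_mulC prod_mul1 prod_mulDl prod_one_neq0.

(** The ideal (direct sum of the Z/pZ) of the families with finite support. *)
Definition sum_Fp (a : prod_Fp) : bool :=
  `[< finite_set [set p : prime_nat | a p != 0] >].

Lemma infinite_prime_nat : ~ finite_set [set: prime_nat].
Proof.
move=> /(finite_image (fun p : prime_nat => val p)) /finite_seqP[s Es].
have [q lt_sq pr_q] := prime_above (\max_(i <- s) i).
have: (range (fun p : prime_nat => val p)) q by exists (exist _ q pr_q).
rewrite Es /= => qs.
by move: lt_sq; rewrite ltnNge (@leq_bigmax_seq _ s xpredT id q).
Qed.

Lemma sum_Fp_idealr_closed : idealr_closed sum_Fp.
Proof.
split.
- apply/asboolP; apply: sub_finite_set (finite_set0 prime_nat) => p /=.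
  by move/negP; apply; apply/eqP.
- apply/negP => /asboolP fin1; apply: infinite_prime_nat.
  by apply: sub_finite_set fin1 => p _ /=; exact: (@oner_neq0 'F_(val p)).
- move=> a u v /asboolP finu /asboolP finv; apply/asboolP.
  apply: (@sub_finite_set _ _ ([set p | u p != 0] `|` [set p | v p != 0])%classic).
    move=> p /= nz; apply/orP; rewrite -negb_and; apply: contra nz.
    move=> /andP[/eqP u0 /eqP v0]; apply/eqP.
    by rewrite [LHS](_ : _ = a p * u p + v p) // u0 v0 mulr0 addr0.
  by rewrite finite_setU.
Qed.

HB.instance Definition _ := isIdealr.Build prod_Fp sum_Fp sum_Fp_idealr_closed.

Definition sum_Fp_ideal : idealr prod_Fp := sum_Fp.

Notation ringA := {ideal_quot sum_Fp_ideal}.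

Lemma ringA_eqP (a b : prod_Fp) :
  \pi_ringA a = \pi_ringA b <-> finite_set [set p : prime_nat | a p != b p].
Proof.
have -> : [set p | a p != b p]%classic = [set p | (a - b) p != 0]%classic.
  by apply: eq_set => p; rewrite -subr_eq0.
split=> [ab|fin]; first by apply/asboolP; move/eqP: ab; rewrite -Quotient.idealrBE.
by apply/eqP; rewrite -Quotient.idealrBE; apply/asboolP.
Qed.

(** The p-component of a truncated multiple harmonic sum: the summation variables
    satisfy 0 < m_1, ..., m_r < p, each lies in [dom], and consecutive ones are
    related by [e] ([ltn] or [leq]).  Every m_i is then nonzero in 'F_p. *)
Definition harmonic_sum (e : rel nat) (dom : pred nat) (k : seq nat) (p : prime_nat)
    : 'F_(val p) :=
  \sum_(m : (size k).-tuple 'I_(val p) |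
        sorted e (map val m) && all (fun x : 'I_(val p) => (0 < x)%N && dom x) m)
    \prod_(i < size k) ((tnth m i)%:R ^+ nth 0%N k i)^-1.

Definition zetaA (k : seq nat) : ringA :=
  \pi_ringA (fun p => harmonic_sum ltn xpredT k p).

(** The condition m < p/2 is expressed as 2m < p. *)
Definition zetaA2 (k : seq nat) : ringA :=
  \pi_ringA (fun p => harmonic_sum ltn (fun m => 2 * m < val p)%N k p).

Definition zetaA2star (k : seq nat) : ringA :=
  \pi_ringA (fun p => harmonic_sum leq (fun m => 2 * m < val p)%N k p).

Lemma harmonic_sum_nil e dom p : harmonic_sum e dom [::] p = 1.
Proof.
rewrite /harmonic_sum (big_pred1 [tuple]) ?big_ord0 // => m.
by rewrite tuple0 [RHS]eqxx.
Qed.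

Lemma zetaA_nil : zetaA [::] = 1.
Proof.
by rewrite /zetaA -[RHS](rmorph1 \pi_ringA); congr (\pi_ringA _);
  apply: functional_extensionality_dep => p; apply: harmonic_sum_nil.
Qed.

Lemma zetaA2_nil : zetaA2 [::] = 1.
Proof.
by rewrite /zetaA2 -[RHS](rmorph1 \pi_ringA); congr (\pi_ringA _);
  apply: functional_extensionality_dep => p; apply: harmonic_sum_nil.
Qed.

Lemma zetaA2star_nil : zetaA2star [::] = 1.
Proof.
by rewrite /zetaA2star -[RHS](rmorph1 \pi_ringA); congr (\pi_ringA _);
  apply: functional_extensionality_dep => p; apply: harmonic_sum_nil.
Qed.

(* Main.v *)
Require Import Defs.
From HB Require Import structures.
From mathcomp Require Import all_boot all_order all_algebra generic_quotient ring_quotient.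
From mathcomp Require Import boolp classical_sets cardinality zify ring.
Import GRing.Theory.
Local Open Scope ring_scope.

Set Implicit Arguments.
Unset Strict Implicit.
Unset Printing Implicit Defensive.

(** The identity already holds modulo each odd prime p, and one prime does not
    matter in the quotient ([ringA_eq_odd]); so fix p = 2h + 1.

    Record nested sums by noncommutative generating series: for a number x let
    e_x be the series of letters z_a (a the exponent) with coefficients x^a.
    Strict sums over x_1 < ... < x_n, read with the index reversed, are the
    coefficients of (1 + e_{x_n}) ... (1 + e_{x_1}), and weak sums over
    x_1 <= ... <= x_m those of (1 - e_{x_1})^-1 ... (1 - e_{x_m})^-1.  With the
    sign (-1)^i the alternating sum of the statement is therefore a coefficient of
    (1 - e_{x_n}) ... (1 - e_{x_1}) (1 - e_{x_1})^-1 ... (1 - e_{x_m})^-1,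
    which telescopes when m <= n and leaves (1 - e_{x_n}) ... (1 - e_{x_{m+1}}).
    This is [alternating_strict_weak], proved by cancelling one variable at a time.

    Taking for the x_j the inverses of 1, ..., p - 1 and m = h, what is left is
    (-1)^r times the strict sum, with the index reversed, over the upper half
    h + 1, ..., 2h.  The reflection m |-> p - m = -m carries the upper half to the
    lower half, reverses the order, and multiplies by (-1)^(k_1 + ... + k_r)
    ([rev_inverses_upper], [strict_sum_rev], [strict_sum_opp]); this is the sign in
    front of the sum.

    The cancellation is done on sums defined by recursion on the list of values;
    [tuple_sum_strict] and [tuple_sum_weak] identify these with sums over
    monotone tuples. *)

(** * Nested sums over a list of values *)

Section NestedSums.

Variable R : comNzRingType.
Implicit Types (s t : seq R) (k : seq nat).

(** The sum of the products x_{j_1}^{k_1} ... x_{j_r}^{k_r} over positions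
    j_1 < ... < j_r in the list, split according to whether the first position
    is used. *)
Fixpoint strict_sum s k : R :=
  match s, k with
  | _, [::] => 1
  | [::], _ :: _ => 0
  | x :: s', a :: k' => strict_sum s' k + x ^+ a * strict_sum s' k'
  end.

(** The analogue with j_1 <= ... <= j_r: the first value stays available after it
    has been used, hence the inner recursion on the exponents alone. *)
Fixpoint weak_sum s : seq nat -> R :=
  match s with
  | [::] => fun k => (nilp k)%:R
  | x :: s' => fix weak_sum_cons k : R :=
      match k with
      | [::] => 1
      | a :: k' => weak_sum s' k + x ^+ a * weak_sum_cons k'
      end
  end.

Lemma strict_sum0 s : strict_sum s [::] = 1.
Proof. by case: s. Qed.

Lemma weak_sum0 s : weak_sum s [::] = 1.
Proof. by case: s. Qed.

(** Splitting on the last position instead of the first, which gives the symmetry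
    under reversal. *)
Lemma strict_sum_rcons s k x a :
  strict_sum (rcons s x) (rcons k a) =
  strict_sum s (rcons k a) + strict_sum s k * x ^+ a.
Proof.
elim: s k => [|y s IHs] [|b k] /=.
- by rewrite !add0r mul1r mulr1.
- by case: k => [|c k] /=; rewrite mulr0 mul0r addr0.
- rewrite -[[:: a]]/(rcons [::] a) IHs !strict_sum0 mulr1 !mul1r.
  by rewrite addrAC.
by rewrite -!rcons_cons !IHs /= mulrDl mulrDr mulrA addrACA.
Qed.

Lemma strict_sum_rev s k : strict_sum (rev s) (rev k) = strict_sum s k.
Proof.
elim: s k => [|x s IHs] [|a k] //.
- by rewrite rev_cons /=; case: (rev k).
- by rewrite /= strict_sum0.
by rewrite !rev_cons strict_sum_rcons -rev_cons !IHs mulrC.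
Qed.

Lemma strict_sum_opp s k :
  strict_sum (map -%R s) k = (-1) ^+ sumn k * strict_sum s k.
Proof.
elim: s k => [|x s IHs] [|a k] /=; rewrite ?mulr0 ?expr0 ?mulr1 //.
by rewrite !IHs /= mulrDr [(- x) ^+ a]exprNn exprD mulrACA.
Qed.

(** The telescoping of the generating series.  The head x of s is the smallest
    variable of both factors: in the strict sums it can only be paired with the
    last exponent of the prefix, in the weak sums with the first exponent of the
    suffix.  Moving this exponent from one side to the other changes i by one and
    so the sign, and all terms that involve x cancel in pairs. *)
Lemma alternating_strict_weak s t k :
  \sum_(i < (size k).+1)
     (-1) ^+ i * strict_sum (s ++ t) (rev (take i k)) * weak_sum s (drop i k) =
  (-1) ^+ size k * strict_sum t (rev k).
Proof.
elim: s => [|x s IHs].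
  (* A weak sum without variables vanishes unless the suffix is empty. *)
  rewrite big_ord_recr /= drop_size take_size mulr1 big1 ?add0r // => i _.
  by rewrite [nilp _](_ : _ = false) ?mulr0 // /nilp size_drop subn_eq0 leqNgt ltn_ord.
pose D i := strict_sum (s ++ t) (rev (take i k)).
pose D' i := strict_sum (x :: s ++ t) (rev (take i k)).
pose S i := weak_sum s (drop i k).
pose S' i := weak_sum (x :: s) (drop i k).
have expD (i : 'I_(size k)) : D' i.+1 = D i.+1 + x ^+ nth 0%N k i * D i.
  by rewrite /D' /D (take_nth 0%N) // rev_rcons.
have expS (i : 'I_(size k)) : S' i = S i + x ^+ nth 0%N k i * S' i.+1.
  by rewrite /S' /S (drop_nth 0%N).
have D'0 : D' 0 = D 0 by rewrite /D' /D take0 !strict_sum0.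
have S'r : S' (size k) = S (size k) by rewrite /S' /S drop_size !weak_sum0.
(* D' contributes the terms x^(k_i) * D_i * S'_(i+1) with sign -(-1)^i, which turn S'
   into S by expS. *)
rewrite -IHs -[LHS]/(\sum_(i < (size k).+1) (-1) ^+ i * D' i * S' i).
rewrite -[RHS]/(\sum_(i < (size k).+1) (-1) ^+ i * D i * S i).
rewrite big_ord_recl D'0; under eq_bigr => i _ do rewrite lift0 expD mulrDr mulrDl.
rewrite big_split /= addrA.
rewrite -(big_ord_recl _ (fun i : 'I_(size k).+1 => (-1) ^+ i * D i * S' i)).
rewrite !big_ord_recr /= S'r addrAC; congr (_ + _); rewrite -big_split /=.
apply: eq_bigr => i _; rewrite expS exprS; ring.
Qed.

End NestedSums.

(** * Sums over monotone tuples *)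

Section TupleSums.

Variables (R : comNzRingType) (T : finType) (v : T -> R).
Implicit Types (e : rel T) (X : seq T) (k : seq nat).

Definition weight n k (m : n.-tuple T) : R :=
  \prod_(i < n) v (tnth m i) ^+ nth 0%N k i.

Definition tuple_sum e X k : R :=
  \sum_(m : (size k).-tuple T | sorted e m && all (mem X) m) weight k m.

Lemma big_tuple_cons n (P : pred (n.+1.-tuple T)) (F : n.+1.-tuple T -> R) :
  \sum_(m | P m) F m =
  \sum_(x : T) \sum_(m : n.-tuple T | P [tuple of x :: m]) F [tuple of x :: m].
Proof.
rewrite pair_big_dep /=.
rewrite (reindex (fun u : T * n.-tuple T => [tuple of u.1 :: u.2])) //=.
exists (fun m : n.+1.-tuple T => (thead m, [tuple of behead m])) => [[x m] _|m _] /=.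
  by congr (_, _); apply: val_inj.
by rewrite -tuple_eta.
Qed.

Lemma weight_cons n x (m : n.-tuple T) a k :
  weight (a :: k) [tuple of x :: m] = v x ^+ a * weight k m.
Proof.
rewrite /weight big_ord_recl; congr (_ * _).
by apply: eq_bigr => i _; rewrite tnthS.
Qed.

Lemma tuple_sum_nil e X : tuple_sum e X [::] = 1.
Proof.
rewrite /tuple_sum (big_pred1 [tuple]) ?/weight ?big_ord0 // => m.
by rewrite tuple0 [RHS]eqxx.
Qed.

Lemma tuple_sum_set0 e a k : tuple_sum e [::] (a :: k) = 0.
Proof. by apply: big1 => m; rewrite (tuple_eta m) /= andbF. Qed.

(** The tuples over x :: X split by whether they start with x.  If they do not,
    then x, being strictly below their head, cannot occur in them at all. *)
Lemma tuple_sum_cons e x X a k : transitive e -> x \notin X ->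
    {in X, forall y, e x y} -> {in X, forall y, ~~ e y x} ->
  tuple_sum e (x :: X) (a :: k) = tuple_sum e X (a :: k) + v x ^+ a *
    \sum_(m : (size k).-tuple T | path e x m && all (mem (x :: X)) m) weight k m.
Proof.
move=> tr_e xX minx exX; rewrite /tuple_sum !big_tuple_cons.
(* The head x contributes nothing to the sum over X, as x is not in X. *)
rewrite (bigD1 x) //= [in RHS](bigD1 x) //= [in RHS]big1; last first.
  by move=> m; rewrite (negPf xX) andbF.
rewrite add0r addrC; congr (_ + _).
  apply: eq_bigr => y neq_yx; apply: eq_bigl => m.
  rewrite !inE (negPf neq_yx) /=; apply: andb_id2l => path_m.
  apply: andb_id2l => yX; apply: eq_in_all => z zm.
  rewrite !inE; case: eqVneq => //= eq_zx.
  move: (order_path_min tr_e path_m) => /allP/(_ z zm).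
  by rewrite eq_zx (negPf (exX y yX)).
rewrite big_distrr /=; apply: eq_big => [m|m _]; last exact: weight_cons.
by rewrite mem_head.
Qed.

Lemma tuple_sum_strict e X k : transitive e -> irreflexive e -> sorted e X ->
  tuple_sum e X k = strict_sum (map v X) k.
Proof.
move=> tr_e irr_e; elim: X k => [|x X IHX] [|a k] srtX;
  rewrite ?tuple_sum_nil ?tuple_sum_set0 ?strict_sum0 //.
have minx : {in X, forall y, e x y}.
  exact/allP/(order_path_min tr_e srtX).
rewrite tuple_sum_cons //=.
- rewrite -!IHX ?(path_sorted srtX) //; congr (_ + _ * _).
  apply: eq_bigl => m; rewrite (path_sortedE tr_e) andbAC -all_predI andbC.
  congr (_ && _); apply: eq_all => y /=; rewrite !inE.
  case: eqVneq => [->|_] /=.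
    by rewrite irr_e; apply/esym/negP => /minx; rewrite irr_e.
  by rewrite andb_idl // => /minx.
- by apply/negP => /minx; rewrite irr_e.
- by move=> y /minx exy; apply/negP => /(tr_e _ _ _ exy); rewrite irr_e.
Qed.

Lemma tuple_sum_weak e X k : transitive e -> reflexive e -> antisymmetric e ->
  uniq X -> sorted e X -> tuple_sum e X k = weak_sum (map v X) k.
Proof.
move=> tr_e refl_e anti_e; elim: X k => [|x X IHX] k.
  by case: k => [|a k]; rewrite ?tuple_sum_nil ?tuple_sum_set0.
case/andP=> xX uX srtX; have minx : {in X, forall y, e x y}.
  exact/allP/(order_path_min tr_e srtX).
elim: k => [|a k IHk]; first by rewrite tuple_sum_nil.
rewrite tuple_sum_cons //.
  rewrite -[RHS]/(weak_sum (map v X) (a :: k)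
                  + v x ^+ a * weak_sum (map v (x :: X)) k).
  rewrite -IHX ?(path_sorted srtX) // -[in RHS]IHk; congr (_ + _ * _).
  apply: eq_bigl => m; rewrite (path_sortedE tr_e) andbAC -all_predI andbC.
  congr (_ && _); apply: eq_all => y /=; rewrite !inE.
  by case: eqVneq => [->|_] /=; rewrite ?refl_e // andb_idl // => /minx.
move=> y yX; apply: contra xX => eyx.
by rewrite (anti_e x y) // minx.
Qed.

End TupleSums.

(** * Truncated harmonic sums modulo an odd prime *)

Section HarmonicSums.

Variables (p : prime_nat).
Let P : nat := val p.

Let v (m : 'I_P) : 'F_P := m%:R^-1.

Definition inverses (s : seq nat) : seq 'F_(val p) := [seq m%:R^-1 | m <- s].

Lemma harmonic_tuple_sum (e : rel nat) dom k :
  harmonic_sum e dom k p =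
  tuple_sum v (relpre val e) [seq m <- enum 'I_P | (0 < val m)%N && dom (val m)] k.
Proof.
apply: eq_big => [m|m _].
  rewrite sorted_map; congr (_ && _); apply: eq_all => x.
  by rewrite /= mem_filter mem_enum andbT.
by apply: eq_bigr => i _; rewrite exprVn.
Qed.

Lemma inverses_enum (dom : pred nat) :
  map v [seq m <- enum 'I_P | (0 < val m)%N && dom (val m)] =
  inverses [seq m <- iota 0 P | (0 < m)%N && dom m].
Proof. by rewrite -val_enum_ord filter_map /inverses -map_comp. Qed.

Let sorted_enum e (dom : pred 'I_P) : transitive e -> sorted e (iota 0 P) ->
  sorted (relpre val e) [seq m <- enum 'I_P | dom m].
Proof.
move=> tr_e srt; apply: sorted_filter; first by move=> y x z; apply: tr_e.
by rewrite -sorted_map val_enum_ord.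
Qed.

Lemma harmonic_sum_ltn dom k :
  harmonic_sum ltn dom k p =
  strict_sum (inverses [seq m <- iota 0 P | (0 < m)%N && dom m]) k.
Proof.
rewrite harmonic_tuple_sum tuple_sum_strict ?inverses_enum //.
- by move=> y x z; apply: ltn_trans.
- by move=> x; apply: ltnn.
by apply: sorted_enum; [apply: ltn_trans | apply: iota_ltn_sorted].
Qed.

Lemma harmonic_sum_leq dom k :
  harmonic_sum leq dom k p =
  weak_sum (inverses [seq m <- iota 0 P | (0 < m)%N && dom m]) k.
Proof.
rewrite harmonic_tuple_sum tuple_sum_weak ?inverses_enum //.
- by move=> y x z; apply: leq_trans.
- by move=> x; apply: leqnn.
- by move=> x y /anti_leq/val_inj.
- by rewrite filter_uniq ?enum_uniq.
by apply: sorted_enum; [apply: leq_trans | apply: iota_sorted].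
Qed.

Hypothesis odd_p : odd P.

Let h := P./2.

Lemma filter_pos : [seq m <- iota 0 P | (0 < m)%N && true] = iota 1 h ++ iota h.+1 h.
Proof.
rewrite -[h.+1]/(1 + h)%N -iotaD addnn -[P]odd_double_half odd_p /=.
by apply/all_filterP/allP => m; rewrite mem_iota andbT => /andP[].
Qed.

Lemma filter_half : [seq m <- iota 0 P | (0 < m)%N && (2 * m < P)%N] = iota 1 h.
Proof.
apply: (irr_sorted_eq ltn_trans ltnn).
- exact/sorted_filter/iota_ltn_sorted/ltn_trans.
- exact: iota_ltn_sorted.
by move=> m; rewrite mem_filter !mem_iota /h; lia.
Qed.

(** The reflection m |-> p - m, which is negation modulo p, exchanges the two
    halves of 1, ..., p - 1 and reverses their order. *)
Lemma rev_inverses_upper : rev (inverses (iota h.+1 h)) = map -%R (inverses (iota 1 h)).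
Proof.
have szI m n : size (inverses (iota m n)) = n by rewrite size_map size_iota.
apply: (@eq_from_nth _ 0); first by rewrite size_rev [RHS]size_map !szI.
move=> i; rewrite size_rev szI => lt_ih.
rewrite nth_rev ?szI // /inverses -map_comp.
rewrite !(nth_map 0%N) ?size_iota ?nth_iota //; try lia.
rewrite /= -invrN; congr _^-1; apply/eqP; rewrite -addr_eq0 -natrD.
have -> : (h.+1 + (h - i.+1) + (1 + i) = P)%N by rewrite /h; lia.
by rewrite pchar_Fp_0 // /P; case: p.
Qed.

Lemma harmonic_sum_identity k :
  harmonic_sum ltn (fun m => 2 * m < val p)%N k p =
  (-1) ^+ (size k + sumn k) * \sum_(i < (size k).+1)
     (-1) ^+ i * harmonic_sum ltn xpredT (rev (take i k)) p
       * harmonic_sum leq (fun m => 2 * m < val p)%N (drop i k) p.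
Proof.
under eq_bigr => i _ do
  rewrite harmonic_sum_ltn harmonic_sum_leq filter_pos filter_half
    [inverses (_ ++ _)]map_cat.
rewrite alternating_strict_weak harmonic_sum_ltn filter_half.
rewrite -[X in strict_sum X (rev k)]revK strict_sum_rev rev_inverses_upper.
rewrite strict_sum_opp [X in _ * X]mulrA -exprD mulrA -exprD.
by rewrite addnn -mul2n exprM sqrrN !expr1n mul1r.
Qed.

End HarmonicSums.

(** * Passage to the quotient *)

Section Components.

Variable p : prime_nat.

(** The projection is named so that its ring morphism structure can be inferred
    and carried through the sum over i. *)
Definition component (a : prod_Fp) : 'F_(val p) := a p.

Lemma component_is_zmod_morphism : zmod_morphism component.
Proof. by []. Qed.

Lemma component_is_monoid_morphism : monoid_morphism component.
Proof. by []. Qed.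

HB.instance Definition _ :=
  GRing.isZmodMorphism.Build prod_Fp 'F_(val p) component component_is_zmod_morphism.
HB.instance Definition _ :=
  GRing.isMonoidMorphism.Build prod_Fp 'F_(val p) component component_is_monoid_morphism.

End Components.

(** Only the component at 2 can differ.  The restriction matters: at p = 2 the
    lower half is empty, and the componentwise identity fails for r = 1. *)
Lemma ringA_eq_odd (a b : prod_Fp) :
  (forall p : prime_nat, odd (val p) -> a p = b p) -> (\pi_ringA a = \pi_ringA b)%qT.
Proof.
move=> eq_ab; apply/ringA_eqP.
apply: sub_finite_set (finite_set1 (exist _ 2%N isT : prime_nat)) => p /= neq_ab.
apply: val_inj => /=; have [//|/eq_ab eqp] := even_prime (valP p).
by rewrite eqp eqxx in neq_ab.
Qed.

Theorem proposition2p2 (r : nat) (k : r.-tuple nat)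
    (r_ge1 : (1 <= r)%N) (k_gt0 : forall i : 'I_r, (0 < tnth k i)%N) :
  zetaA2 k = (-1) ^+ (r + \sum_(i < r) tnth k i)%N *
    \sum_(i < r.+1) (-1) ^+ i * zetaA (rev (take i k)) * zetaA2star (drop i k).
Proof.
pose sgn n : prod_Fp := (-1) ^+ n.
have sgnE n : (-1) ^+ n = (\pi_ringA (sgn n))%qT by rewrite rmorphXn rmorphN1.
rewrite sgnE.
(* Both sides are brought to the form of a class of one family. *)
under [X in _ * X]eq_bigr => i _ do rewrite sgnE /zetaA /zetaA2star -!rmorphM.
rewrite -rmorph_sum -rmorphM; apply: ringA_eq_odd => p odd_p.
rewrite harmonic_sum_identity // -[RHS]/(component p _) rmorphM rmorph_sum.
rewrite rmorphXn rmorphN1 size_tuple sumnE big_tuple.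
congr (_ * _); apply: eq_bigr => i _.
by rewrite !rmorphM rmorphXn rmorphN1.
Qed.
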